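(* Let $k\geq 2$ and $n\geq 2k+1$ be integers, and let $C_n^k$ denote the circulant graph $Ci_n(1,2,\dots,k)$. Then \[ s(C_n^k)=\begin{cases}\left\lceil\frac{n+2k-1}{2k}\right\rceil+1, & \text{if } \big(n \bmod 4k = 2k+1 \text{ and } k \bmod 2=1\big) \text{ or } n=2k+1,\\[4pt] \left\lceil\frac{n+2k-1}{2k}\right\rceil, & \text{otherwise.}\end{cases} \]
   Context: For integers $n$ and $1\le k\le n/2$, the circulant graph $Ci_n(1,2,\dots,k)$ (the $k$-th power $C_n^k$ of the cycle $C_n$) is the simple graph with vertex set $\{0,1,\dots,n-1\}$ in which $x$ is adjacent to $x\pm i \pmod n$ for every $1\le i\le k$. For a simple graph $G$ with no isolated edges and at most one isolated vertex, an edge labelling $w:E(G)\to\{1,2,\dots,s\}$ assigns to each vertex $v$ the weighted degree $wd(v)=\sum_{e\ni v}w(e)$; the labelling is irregular if the weighted degrees of all vertices are pairwise distinct. The irregularity strength $s(G)$ is the smallest integer $s$ for which such an irregular edge labelling with labels in $\{1,\dots,s\}$ exists. *)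

(* Defs.v *)
From mathcomp Require Import all_boot all_order all_algebra.
Set Implicit Arguments.
Unset Strict Implicit.
Unset Printing Implicit Defensive.

Record sgraph := SGraph {
  vertex :> finType;
  adj : rel vertex;
  adj_sym : symmetric adj;
  adj_irr : irreflexive adj }.

Definition edges (G : sgraph) : {set {set G}} :=
  [set [set p.1; p.2] | p : G * G & adj p.1 p.2].

(* Only the values of [w] on [edges G] matter, here and below. *)
Definition edge_labelling (G : sgraph) (s : nat) (w : {set G} -> nat) : Prop :=
  forall e, e \in edges G -> 1 <= w e <= s.

Definition weighted_degree (G : sgraph) (w : {set G} -> nat) (v : G) : nat :=
  \sum_(e in edges G | v \in e) w e.

Definition has_irregular_labelling (G : sgraph) (s : nat) : Prop :=
  exists w : {set G} -> nat,
    edge_labelling s w /\ injective (weighted_degree w).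

(* s(G) = s; stated as a relation, since s(G) is undefined for graphs that
   have no irregular labelling. *)
Definition irregularity_strength (G : sgraph) (s : nat) : Prop :=
  has_irregular_labelling G s /\
  forall t, has_irregular_labelling G t -> s <= t.

(* y = x + i or y = x - i modulo n, for some i in L; the subtraction is
   written as x = y + i because nat subtraction truncates. *)
Definition circulant_adj (n : nat) (L : seq nat) : rel 'I_n :=
  fun x y => (x != y) &&
    has (fun i => (y == x + i %[mod n]) || (x == y + i %[mod n])) L.

Lemma circulant_adj_sym n L : symmetric (@circulant_adj n L).
Proof.
move=> x y; rewrite /circulant_adj eq_sym; congr (_ && _).
by apply: eq_has => i; rewrite orbC.
Qed.

Lemma circulant_adj_irr n L : irreflexive (@circulant_adj n L).
Proof. by move=> x; rewrite /circulant_adj eqxx. Qed.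

Definition circulant (n : nat) (L : seq nat) : sgraph :=
  SGraph (@circulant_adj_sym n L) (@circulant_adj_irr n L).

Definition cycle_power (n k : nat) : sgraph := circulant n (iota 1 k).

(* Main.v *)
Require Import Defs.
From mathcomp Require Import all_boot all_order all_algebra.
From mathcomp Require Import zify lra.
Set Implicit Arguments.
Unset Strict Implicit.
Unset Printing Implicit Defensive.
Import GRing.Theory Num.Theory.

(* Lower bound: the n distinct weighted degrees lie in [2k, 2ks], an interval
   of 2k(s-1)+1 integers.  If all of them are attained, their sum, which is
   twice the sum of the labels, must be even, and this fails when k is odd and
   n = 2k+1 modulo 4k; for n = 2k+1 the vertices of degree 2k and 4k would be
   adjacent, with all edges of the former labelled 1 and all edges of the latter
   labelled 2.

   Upper bound: write n = 2kK + w with 2 <= w <= 2k+1, and subtract 1 from the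
   labels, so that 0, ..., K+1 are available.  Number the vertices in zigzag
   order (even ranks down one side of the cycle, odd ranks up the other side)
   and label an edge by the number of thresholds below the sum of the ranks of
   its ends.  Each threshold contributes a half graph, whose degrees are distinct
   up to one coincidence.  So the degrees follow the ranks, except that for each
   t < K the value 2kt+k is taken twice and 2kt+2k is free, and that one value is
   taken twice near the top.  In a triangle, adding 1 to the two edges at u and
   subtracting 1 from the third edge raises the degree of u by 2 and changes no
   other degree.  Edge-disjoint triangles raise one vertex of each coincidence to
   a free value; when k is odd each needs the odd amount k, and consecutive
   coincidences are paired by also raising the edge between them. *)

(** * Labellings of powers of cycles *)

Ltac lia_if :=
  repeat match goal with
  | |- context [if ?b then _ else _] =>
      lazymatch b with
      | context [if _ then _ else _] => fail
      | _ => case: (boolP b) => ?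
      end
  end; lia.

Lemma set2_inj (T : finType) (v a b : T) :
  a != v -> b != v -> [set v; a] = [set v; b] -> a = b.
Proof.
move=> av bv /setP /(_ a); rewrite !inE eqxx orbT (negPf av) /=.
by move/esym/eqP.
Qed.

Lemma adj_neq (G : sgraph) (x y : G) : adj x y -> x != y.
Proof. by apply: contraTneq => ->; rewrite adj_irr. Qed.

Lemma edgesP (G : sgraph) (e : {set G}) :
  reflect (exists x y : G, adj x y /\ e = [set x; y]) (e \in edges G).
Proof.
apply: (iffP imsetP) => [[[x y]]|[x [y [xy ->]]]].
  by rewrite inE /= => xy ->; exists x, y.
by exists (x, y); rewrite ?inE.
Qed.

Lemma weighted_degreeE (G : sgraph) (w : {set G} -> nat) (v : G) :
  weighted_degree w v = \sum_(y | adj v y) w [set v; y].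
Proof.
transitivity (\sum_(e in [set [set v; y] | y in [set y | adj v y]]) w e).
  apply: eq_bigl => e; apply/andP/imsetP => [[/edgesP[x [y [xy ->]]]]|[y]].
    rewrite !inE => /orP[] /eqP ->; first by exists y; rewrite ?inE.
    by exists x; rewrite ?inE 1?setUC // adj_sym.
  rewrite inE => vy ->; rewrite !inE eqxx; split=> //.
  by apply/edgesP; exists v, y.
rewrite big_imset /=; first by apply: eq_bigl => y; rewrite inE.
move=> a b; rewrite !inE => /adj_neq va /adj_neq vb.
by apply: set2_inj; rewrite eq_sym.
Qed.

Lemma handshake (G : sgraph) (w : {set G} -> nat) :
  \sum_v weighted_degree w v = 2 * \sum_(e in edges G) w e.
Proof.
rewrite /weighted_degree (exchange_big_dep (mem (edges G))) /=; last first.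
  by move=> v e _ /andP[].
rewrite big_distrr /=; apply: eq_bigr => e eE.
rewrite (eq_bigl (fun v => v \in e)) => [|v]; last by rewrite eE.
rewrite sum_nat_const; congr (_ * _).
by case/edgesP: eE => x [y [/adj_neq xy ->]]; rewrite cards2 xy.
Qed.

Definition cyc_next (n v i : nat) := if v + i < n then v + i else v + i - n.
Definition cyc_prev (n v i : nat) := if i <= v then v - i else v + n - i.

Lemma eqn_modD (n v y i : nat) : v < n -> y < n -> i < n ->
  (y == v + i %[mod n]) = (y == cyc_next n v i).
Proof.
move=> vn yn lin; rewrite (modn_small yn) /cyc_next.
case: ltnP => h; first by rewrite modn_small.
by rewrite -[in LHS](subnK h) modnDr modn_small //; lia.
Qed.

Lemma cycle_power_adjE (n k : nat) (v y : 'I_n) : 2 * k < n ->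
  circulant_adj (iota 1 k) v y =
  ((y : nat) \in [seq cyc_next n v i | i <- iota 1 k] ++
                 [seq cyc_prev n v i | i <- iota 1 k]).
Proof.
move=> kn; have vn := ltn_ord v; have yn := ltn_ord y.
rewrite /circulant_adj mem_cat; apply/andP/orP => [[_ /hasP[i]]|[] /mapP[i]];
  rewrite mem_iota => hi.
- rewrite !eqn_modD //; try lia; case/orP=> /eqP h; [left|right];
    apply/mapP; exists i; rewrite ?mem_iota //.
  by move: h; rewrite /cyc_prev /cyc_next; lia_if.
- move=> h; split.
    by apply/negP=> /eqP/(congr1 (@nat_of_ord n)); move: h; rewrite /cyc_next;
      lia_if.
  by apply/hasP; exists i; rewrite ?mem_iota // eqn_modD ?h ?eqxx //; lia.
- move=> h; split.
    by apply/negP=> /eqP/(congr1 (@nat_of_ord n)); move: h; rewrite /cyc_prev;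
      lia_if.
  apply/hasP; exists i; rewrite ?mem_iota //; apply/orP; right.
  rewrite eqn_modD //; last lia.
  by apply/eqP; move: h; rewrite /cyc_prev /cyc_next; lia_if.
Qed.

(** As [2k < n], the [2k] positions at distance 1 to [k] from [v] are pairwise distinct, so sums
    over neighbours become sums over offsets. *)
Lemma sum_adj (n k : nat) (v : 'I_n) (g : nat -> nat) : 2 * k < n ->
  \sum_(y : 'I_n | circulant_adj (iota 1 k) v y) g y =
  \sum_(1 <= i < k.+1) (g (cyc_next n v i) + g (cyc_prev n v i)).
Proof.
move=> kn; have vn := ltn_ord v.
set L := [seq cyc_next n v i | i <- iota 1 k] ++
         [seq cyc_prev n v i | i <- iota 1 k].
transitivity (\sum_(z <- L) g z).
  transitivity (\sum_(z <- [seq val y | y <- enum 'I_n & circulant_adj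
    (iota 1 k) v y]) g z).
    by rewrite big_map big_filter big_enum_cond.
  apply: perm_big; apply: uniq_perm.
  - by rewrite (map_inj_uniq val_inj) filter_uniq ?enum_uniq.
  - rewrite cat_uniq !map_inj_in_uniq ?iota_uniq ?andbT /=.
    + apply/hasPn => z /mapP[i]; rewrite mem_iota => hi ->; apply/mapP => -[j].
      by rewrite mem_iota /cyc_prev /cyc_next; lia_if.
    + by move=> i j; rewrite !mem_iota /cyc_prev; lia_if.
    + by move=> i j; rewrite !mem_iota /cyc_next; lia_if.
  - move=> z; apply/mapP/idP => [[y]|zL].
      by rewrite mem_filter cycle_power_adjE // => /andP[h _] ->.
    have zn : z < n.
      move: zL; rewrite mem_cat => /orP[] /mapP[i]; rewrite mem_iota => hi ->;
        rewrite /cyc_prev /cyc_next; lia_if.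
    exists (Ordinal zn) => //.
    by rewrite mem_filter cycle_power_adjE // zL mem_enum.
by rewrite big_cat !big_map /= big_split /= /index_iota subn1.
Qed.

(* On a two-element set exactly one summand survives. *)
Definition set_label (n : nat) (l : nat -> nat -> nat) (e : {set 'I_n}) : nat :=
  \sum_(x in e) \sum_(y in e | (x : nat) < y) l x y.

Lemma set_label2 (n : nat) (l : nat -> nat -> nat) (x y : 'I_n) : x != y ->
  set_label l [set x; y] = l (minn x y) (maxn x y).
Proof.
wlog xy : x y / (x : nat) < y => [W|] nxy.
  case: (boolP (x < y)) => h; first exact: W.
  rewrite setUC minnC maxnC; apply: W; last by rewrite eq_sym.
  by rewrite ltn_neqAle leqNgt h andbT eq_sym.
rewrite /set_label big_setU1 ?inE //= big_set1.
rewrite (big_pred1 y) => [|z]; last first.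
  rewrite !inE; case: (eqVneq z y) => [->|zy]; rewrite ?orbT //= orbF.
  by case: (eqVneq z x) => //= ->; rewrite ltnn.
rewrite big_pred0 => [|z]; last first.
  by rewrite !inE; apply/negP => /andP[/orP[] /eqP ->]; lia.
by rewrite addn0; congr l; lia.
Qed.

Definition pair_minmax (x y : nat) : nat * nat := (minn x y, maxn x y).

(** The degree of [v] in the multigraph with edge list [s]. *)
Definition touches (v : nat) (s : seq (nat * nat)) : nat :=
  \sum_(e <- s) ((e.1 == v) + (e.2 == v)).

(** Edges that do not wrap around from [n-1] to 0; every correction is made on such edges. *)
Definition edge_list (n k : nat) (s : seq (nat * nat)) : bool :=
  all (fun e => [&& e.1 < e.2, e.2 <= e.1 + k & e.2 < n]) s.

Lemma sum_count_mem (n k : nat) (v : 'I_n) (s : seq (nat * nat)) :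
  2 * k < n -> edge_list n k s ->
  \sum_(y : 'I_n | circulant_adj (iota 1 k) v y)
     count_mem (pair_minmax v y) s = touches v s.
Proof.
move=> kn; have vn := ltn_ord v.
elim: s => [|[a b] s IH] /=; first by rewrite /touches big_nil big1.
case/andP=> /and3P[ab bk bn] /IH IHs.
rewrite big_split /= IHs /touches big_cons /=; congr (_ + _).
rewrite (eq_bigr (fun y : 'I_n => (a == minn v y) && (b == maxn v y) : nat)) //.
rewrite (@sum_adj n k v (fun y => (a == minn v y) && (b == maxn v y) : nat)) //.
(* Only the offset [b - a] can hit the edge: forwards from [a], backwards from [b]. *)
case: (eqVneq a v) => [av|av]; [|case: (eqVneq b v) => [bv|bv]].
- rewrite (_ : b == v = false) ?addn0; last lia.
  rewrite (bigD1_seq (b - a)) ?iota_uniq ?mem_index_iota //=; last lia.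
  rewrite big1_seq ?addn0; last first.
    move=> i /andP[ib]; rewrite mem_index_iota => hi.
      rewrite /cyc_next /cyc_prev; lia_if.
  rewrite /cyc_next /cyc_prev; lia_if.
- rewrite (bigD1_seq (b - a)) ?iota_uniq ?mem_index_iota //=; last lia.
  rewrite big1_seq ?addn0; last first.
    move=> i /andP[ib]; rewrite mem_index_iota => hi.
      rewrite /cyc_next /cyc_prev; lia_if.
  rewrite /cyc_next /cyc_prev; lia_if.
- rewrite big_nat big1 // => i hi; rewrite /cyc_next /cyc_prev; lia_if.
Qed.

(* The label of [e] is [1 + base e + (e \in P) - (e \in N)]. *)
Lemma corrected_labelling (n k s : nat) (base : nat -> nat -> nat)
    (P N : seq (nat * nat)) (F : nat -> nat) :
  2 * k < n ->
  (forall x y, base x y = base y x) ->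
  (forall x y, base x y < s) ->
  edge_list n k P -> edge_list n k N -> uniq P -> uniq N ->
  (forall e, e \in P -> (base e.1 e.2).+1 < s) ->
  (forall e, e \in N -> 0 < base e.1 e.2) ->
  (forall v, v < n ->
    \sum_(1 <= i < k.+1) (base v (cyc_next n v i) + base v (cyc_prev n v i))
      + touches v P = F v + touches v N) ->
  (forall x y, x < n -> y < n -> F x = F y -> x = y) ->
  has_irregular_labelling (cycle_power n k) s.
Proof.
move=> kn baseC bs eP eN uP uN hP hN hF injF.
pose c x y := base x y + count_mem (x, y) P - count_mem (x, y) N.
pose l x y := (c x y).+1.
exists (set_label l); split=> [e|].
  case/edgesP => x [y [/adj_neq xy ->]]; rewrite set_label2 // /l /c ltnS /=.
  rewrite !count_uniq_mem //.
  have := hP (minn x y, maxn x y).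
  have := bs (minn x y) (maxn x y).
  by case: (_ \in P) => /= ? h; [have := h isT|]; lia.
have deg (v : 'I_n) : weighted_degree (G := cycle_power n k) (set_label l) v
    = F v + 2 * k.
  rewrite weighted_degreeE.
  pose m (y : 'I_n) := pair_minmax v y.
  transitivity (\sum_(y : 'I_n | circulant_adj (iota 1 k) v y)
     (base v y + count_mem (m y) P - count_mem (m y) N).+1).
    apply: eq_bigr => y vy; rewrite set_label2 ?(adj_neq vy) //.
    rewrite /l /c /m /pair_minmax; congr _.+1; congr (_ + _ - _).
    by rewrite /minn /maxn; case: ltnP => //; rewrite baseC.
  (* Adding the [N]-count to both sides undoes the truncated subtraction, which loses nothing
     because lowered edges have positive base. *)
  apply/eqP; rewrite -(eqn_add2r (touches v N)) -(sum_count_mem (k := k) v) //.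
  rewrite -big_split /=.
  rewrite (eq_bigr (fun y : 'I_n => (base v y + 1) + count_mem (m y) P));
    last first.
    move=> y _; rewrite -/(m y).
    set cP := count_mem (m y) P; set cN := count_mem (m y) N.
    suff : cN <= base v y + cP by lia.
    rewrite /cN (count_uniq_mem _ uN); case: (boolP (m y \in N)) => // /hN.
    by rewrite /m /pair_minmax /minn /maxn /=; case: (ltnP v y) => _;
      rewrite ?(baseC y); lia.
  rewrite big_split /= sum_count_mem //.
  rewrite (@sum_adj n k v (fun y => base v y + 1)) //.
  rewrite (eq_bigr (fun i => (base v (cyc_next n v i) + base v
    (cyc_prev n v i)) + 2)); last by move=> i _; lia.
  rewrite big_split /= sum_nat_const_nat sum_count_mem //.
  have := hF v (ltn_ord v); lia.
by move=> x y; rewrite !deg => /addIn /injF h; apply: val_inj; apply: h.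
Qed.

(** * The zigzag labelling *)

(* Vertices of small rank sit around the edge between positions [n-1] and [0];
   odd ranks increase along the positions, even ranks decrease. *)
Definition rank (n x : nat) : nat :=
  if 2 * x + 1 < n then 2 * x + 1 else 2 * (n - 1 - x).

Lemma rank_inj (n x y : nat) : x < n -> y < n -> rank n x = rank n y -> x = y.
Proof. rewrite /rank; lia_if. Qed.

Lemma rank_lt (n x : nat) : x < n -> rank n x < n.
Proof. rewrite /rank; lia_if. Qed.

(** Each step along the cycle changes the rank by 2; past an end of the zigzag the walk is reflected
    to ranks of the other parity. *)
Definition rank_up (n r i : nat) : nat :=
  if r + 2 * i < n then r + 2 * i else 2 * n - 1 - r - 2 * i.

Definition rank_down (r i : nat) : nat :=
  if 2 * i <= r then r - 2 * i else 2 * i - r - 1.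

(** Along increasing positions odd ranks grow and even ranks fall, so only the sum over both
    directions has a uniform form. *)
Lemma rank_neighbours (n v i : nat) (g : nat -> nat) :
  v < n -> 0 < i -> 2 * i < n ->
  g (rank n (cyc_next n v i)) + g (rank n (cyc_prev n v i)) =
  g (rank_up n (rank n v) i) + g (rank_down (rank n v) i).
Proof.
move=> vn i0 lin; case: (boolP (2 * v + 1 < n)) => h.
  congr (g _ + g _); rewrite /rank /cyc_next /cyc_prev /rank_up /rank_down; lia_if.
rewrite addnC.
congr (g _ + g _); rewrite /rank /cyc_next /cyc_prev /rank_up /rank_down; lia_if.
Qed.

(** The threshold [4kt+2k+2] is twice the rank [2kt+k+1] in the middle of the block
    [2kt+1, ..., 2kt+2k]; the last one is twice the midpoint of the ranks [2kK+1, ..., 2kK+w-1]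
    above all blocks. *)
Definition level (k K w s : nat) : nat :=
  \sum_(0 <= t < K) (4 * (k * t) + 2 * k + 2 <= s) + (4 * (k * K) + w <= s).

Lemma sum_bool_le (K : nat) (P : nat -> bool) :
  \sum_(0 <= t < K) (P t : nat) <= K.
Proof.
rewrite -[leqRHS]subn0 -[leqRHS]muln1 -sum_nat_const_nat.
by apply: leq_sum => i _; apply: leq_b1.
Qed.

Lemma level_le (k K w s : nat) : level k K w s <= K.+1.
Proof. by rewrite /level -[K.+1]addn1 leq_add ?leq_b1 ?sum_bool_le. Qed.

Lemma level_lt (k K w s : nat) : s < 4 * (k * K) + w -> level k K w s <= K.
Proof.
by move=> h; rewrite /level [4 * _ + w <= _]leqNgt h addn0 sum_bool_le.
Qed.

Lemma level_gt0 (k K w s : nat) :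
  (0 < K /\ 2 * k + 2 <= s) \/ (4 * (k * K) + w <= s) -> 0 < level k K w s.
Proof.
rewrite /level => -[[K0 h]|->]; last by rewrite addn1.
by rewrite big_ltn // muln0 muln0 add0n h.
Qed.

Lemma sum_interval (k a b : nat) :
  \sum_(1 <= i < k.+1) (a < i <= b) = minn k b - a.
Proof.
elim: k => [|k IH]; first by rewrite big_geq //; lia.
by rewrite big_nat_recr //= IH; lia.
Qed.

Lemma touches_cat (v : nat) (s1 s2 : seq (nat * nat)) :
  touches v (s1 ++ s2) = touches v s1 + touches v s2.
Proof. by rewrite /touches big_cat. Qed.

Lemma touches_map (I : Type) (v : nat) (f : I -> nat * nat) (s : seq I) :
  touches v [seq f i | i <- s] =
  \sum_(i <- s) (((f i).1 == v) + ((f i).2 == v)).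
Proof. by rewrite /touches big_map. Qed.

Lemma euclid_inj (k t t' a a' : nat) : a < k -> a' < k ->
  k * t + a = k * t' + a' -> t = t' /\ a = a'.
Proof.
move=> ak ak' e; have k0 : 0 < k by lia.
have := congr1 (fun x => x %/ k) e; have := congr1 (fun x => x %% k) e.
by rewrite ![k * _]mulnC !modnMDl !divnMDl // !modn_small // !divn_small // !addn0.
Qed.

Lemma sum_pred_at (m q c : nat) (P : nat -> bool) :
  (forall t, t < m -> P t = (t == q)) -> \sum_(0 <= t < m) c * P t = (q < m) * c.
Proof.
move=> H; case: (ltnP q m) => qm.
  rewrite (bigD1_seq q) ?mem_index_iota ?iota_uniq //= H // eqxx big1_seq;
    first by lia.
  by move=> t; rewrite mem_index_iota /= => /andP[tq tm];
    rewrite H // (negPf tq) muln0.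
rewrite big1_seq //= => t; rewrite mem_index_iota /= => tm.
by rewrite H // (_ : (t == q) = false) ?muln0 //; lia.
Qed.

(** * Fans of triangles *)

(** For triangles [p, f i, g i] with common apex [p], these are the sides at [p], to be raised;
    [fan_minus] holds the opposite sides, to be lowered. *)
Definition fan_plus (p : nat) (f g : nat -> nat) (s : seq nat) : seq (nat * nat) :=
  [seq pair_minmax p (f i) | i <- s] ++ [seq pair_minmax p (g i) | i <- s].

Definition fan_minus (f g : nat -> nat) (s : seq nat) : seq (nat * nat) :=
  [seq pair_minmax (f i) (g i) | i <- s].

Lemma touches_nil (v : nat) : touches v [::] = 0.
Proof. by rewrite /touches big_nil. Qed.

Lemma touches_minmax (v x y : nat) (s : seq (nat * nat)) :
  touches v (pair_minmax x y :: s) = (x == v) + (y == v) + touches v s.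
Proof. by rewrite /touches big_cons /=; congr (_ + _); lia. Qed.

(** At [f i] and [g i] the raised and the lowered side cancel; the apex keeps 2 per triangle. *)
Lemma touches_fan (v p : nat) (f g : nat -> nat) (s : seq nat) :
  touches v (fan_plus p f g s) =
  2 * size s * (p == v) + touches v (fan_minus f g s).
Proof.
rewrite touches_cat; elim: s => [|i s IH]; first by rewrite /touches !big_nil.
by rewrite /= !touches_minmax; case: eqVneq IH; lia.
Qed.

Lemma fan_plusP (p : nat) (f g : nat -> nat) (s : seq nat) e :
  e \in fan_plus p f g s ->
  exists2 i, i \in s & e = pair_minmax p (f i) \/ e = pair_minmax p (g i).
Proof.
by rewrite mem_cat => /orP[] /mapP[i is_i ->]; exists i => //; [left|right].
Qed.

Lemma uniq_fan_plus (p : nat) (f g : nat -> nat) (s : seq nat) : uniq s ->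
  {in s &, injective f} -> {in s &, injective g} ->
  {in s &, forall i j, f i <> g j} -> uniq (fan_plus p f g s).
Proof.
move=> us fi gi fg; rewrite cat_uniq !map_inj_in_uniq ?us //= ?andbT.
- apply/hasPn => e /mapP[i si ->]; apply/mapP => -[j sj [e1 e2]].
  by apply: (fg j i) => //; lia.
- by move=> i j si sj [e1 e2]; apply: gi => //; lia.
- by move=> i j si sj [e1 e2]; apply: fi => //; lia.
Qed.

Lemma uniq_fan_minus (f g : nat -> nat) (s : seq nat) : uniq s ->
  {in s &, injective (fun i => pair_minmax (f i) (g i))} ->
  uniq (fan_minus f g s).
Proof. by move=> us fg; rewrite map_inj_in_uniq. Qed.

(** * Degrees in the zigzag labelling *)

Section Zigzag.

Variables (k K w n : nat).
Hypotheses (k1 : 1 < k) (w1 : 1 < w) (wk : w <= 2 * k + 1).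
Hypotheses (nE : n = 2 * (k * K) + w) (kn : 2 * k < n).

(** The degree at rank [r] in the half graph of the edges with rank sum at least [th]. *)
Definition threshold_degree (th r : nat) : nat :=
  \sum_(1 <= i < k.+1)
     ((th <= r + rank_up n r i) + (th <= r + rank_down r i)).

(** Reflected neighbours have rank sums [2n-1-2i] and [2i-1], above and below the threshold. The
    value [k] occurs at both [2kt+k] and [2kt+k+1]: at the latter [2r] is the threshold itself, but
    a vertex is not its own neighbour. *)
Lemma threshold_degreeE (t r : nat) : t < K -> r < n ->
  threshold_degree (4 * (k * t) + 2 * k + 2) r =
  (k - (2 * (k * t) + k - r)) + minn k (r - (2 * (k * t) + k + 1)).
Proof.
move=> tK rn.
have H : k * t + k <= k * K by rewrite -mulnSr leq_mul2l tK orbT.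
rewrite /threshold_degree big_split /=; congr (_ + _).
  rewrite -[in RHS](minnn k) -sum_interval; apply: eq_big_nat => i hi.
  congr nat_of_bool; rewrite /rank_up; lia_if.
rewrite -[RHS]subn0 -sum_interval; apply: eq_big_nat => i hi.
congr nat_of_bool; rewrite /rank_down; lia_if.
Qed.

(** Here reflection matters: a neighbour reflected at the top has rank sum [2n-1-2i], which reaches
    the threshold only for [i <= (w-1)./2]. *)
Lemma top_threshold_degreeE (r : nat) : r < n ->
  threshold_degree (4 * (k * K) + w) r =
  ((w - 1)./2 - (2 * n - w - 2 * r).-1./2 - (r <= 2 * (k * K)) * k)
     + (2 * r - (2 * n - w))./2.
Proof.
move=> rn.
rewrite /threshold_degree big_split /=; congr (_ + _).
  case: (leqP r (2 * (k * K))) => hr.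
    rewrite big_nat big1; first lia.
    move=> i hi; rewrite /rank_up; lia_if.
  rewrite mul0n subn0 (_ : (w - 1)./2 = minn k (w - 1)./2); last lia.
  rewrite -sum_interval; apply: eq_big_nat => i hi.
  congr nat_of_bool; rewrite /rank_up; lia_if.
rewrite (_ : (2 * r - _)./2 = minn k (2 * r - (2 * n - w))./2); last lia.
rewrite -[RHS]subn0 -sum_interval; apply: eq_big_nat => i hi.
congr nat_of_bool; rewrite /rank_down; lia_if.
Qed.

Definition base (x y : nat) : nat := level k K w (rank n x + rank n y).

Definition base_degree (v : nat) : nat :=
  \sum_(1 <= i < k.+1) (base v (cyc_next n v i) + base v (cyc_prev n v i)).

Lemma base_degree_threshold (v : nat) : v < n ->
  base_degree v =
  \sum_(0 <= t < K) threshold_degree (4 * (k * t) + 2 * k + 2) (rank n v)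
  + threshold_degree (4 * (k * K) + w) (rank n v).
Proof.
move=> vn; rewrite /base_degree /threshold_degree exchange_big -big_split /=.
apply: eq_big_nat => i hi.
rewrite (rank_neighbours (fun r => level k K w (rank n v + r))) //; try lia.
rewrite /level big_split /=; lia.
Qed.

Lemma base_degree0 (v : nat) : v < n -> rank n v = 0 -> base_degree v = 0.
Proof.
move=> vn r0; rewrite base_degree_threshold // r0 top_threshold_degreeE //;
  last lia.
rewrite big_nat big1 => [|t ht]; first by lia.
by rewrite threshold_degreeE; lia.
Qed.

(** The [q] lower thresholds contribute [2k] each, the block's own one [r - (k < r)], the higher
    ones nothing. *)
Lemma base_degree_block (v q r : nat) : v < n -> q < K -> 0 < r <= 2 * k ->
  rank n v = 2 * (k * q) + r -> base_degree v = 2 * (k * q) + (r - (k < r)).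
Proof.
move=> vn qK hr rv.
have H : k * q + k <= k * K by rewrite -mulnSr leq_mul2l qK orbT.
rewrite base_degree_threshold // rv top_threshold_degreeE; last lia.
rewrite (_ : (_ <= 2 * (k * K)) = true) ?mul1n; last lia.
rewrite (_ : _ - _ - k = 0); last lia.
rewrite (_ : (_ - (2 * n - w))./2 = 0) ?addn0; last lia.
rewrite (@big_cat_nat _ _ _ q) ?(ltnW qK) //=.
rewrite (big_ltn qK) [X in _ + (_ + X)]big1_seq.
  rewrite threshold_degreeE //; last lia.
  rewrite (eq_big_nat _ _ (F2 := fun=> 2 * k)).
    rewrite sum_nat_const_nat subn0 (_ : q * (2 * k) = 2 * (k * q)); last first.
      by rewrite mulnCA (mulnC q).
    by case: (leqP r k) => rk; lia.
  move=> t ht; have H2 : k * t + k <= k * q by rewrite -mulnSr leq_mul2l; lia.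
  by rewrite threshold_degreeE; lia.
move=> t; rewrite mem_index_iota /= => ht.
have H2 : k * q + k <= k * t by rewrite -mulnSr leq_mul2l; lia.
by rewrite threshold_degreeE; lia.
Qed.

Lemma base_degree_top (v r : nat) : v < n -> 0 < r < w ->
  rank n v = 2 * (k * K) + r ->
  base_degree v = 2 * (k * K) + (r - (w <= 2 * r)).
Proof.
move=> vn hr rv.
rewrite base_degree_threshold // rv top_threshold_degreeE; last lia.
rewrite (eq_big_nat _ _ (F2 := fun=> 2 * k)).
  rewrite sum_nat_const_nat subn0 (_ : K * (2 * k) = 2 * (k * K)); last first.
    by rewrite mulnCA (mulnC K).
  lia.
move=> t ht; have H2 : k * t + k <= k * K by rewrite -mulnSr leq_mul2l; lia.
by rewrite threshold_degreeE; lia.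
Qed.

(* One of the two vertices of degree [2kt + k] in the zigzag labelling. *)
Definition cut (t : nat) : nat := k * t + k./2.

Lemma cutS (t : nat) : cut t.+1 = cut t + k.
Proof. by rewrite /cut mulnS; lia. Qed.

Lemma cut_bound (t : nat) : t < K -> cut t + k <= k * K + k./2.
Proof.
move=> tK; have : k * t + k <= k * K by rewrite -mulnSr leq_mul2l tK orbT.
by rewrite /cut; lia.
Qed.

Lemma cut_inj (t t' : nat) : cut t = cut t' -> t = t'.
Proof. by move/euclid_inj => [] //; lia. Qed.

(* The pairs [cut t - i], [cut t + (k - i)] of adjacent neighbours of [cut t]
   form triangles with it; [star_edges] are to be raised, [match_edges] lowered. *)
Definition star_edges : seq (nat * nat) :=
  [seq (cut t - i, cut t) | t <- iota 0 K, i <- iota 1 k./2] ++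
  [seq (cut t, cut t + (k - i)) | t <- iota 0 K, i <- iota 1 k./2].

Definition match_edges : seq (nat * nat) :=
  [seq (cut t - i, cut t + (k - i)) | t <- iota 0 K, i <- iota 1 k./2].

(** Consecutive cuts are exactly [k] apart, hence adjacent. These disjoint edges supply the odd unit
    to the first [2m] cuts. *)
Definition link_edges (m : nat) : seq (nat * nat) :=
  [seq (cut (2 * j), cut (2 * j).+1) | j <- iota 0 m].

Lemma star_edgesP e : e \in star_edges ->
  exists t i, [/\ t < K, 0 < i <= k./2 &
    e = (cut t - i, cut t) \/ e = (cut t, cut t + (k - i))].
Proof.
rewrite mem_cat => /orP[] /allpairsP [[t i]] /=;
  rewrite !mem_iota => -[ht hi ->]; exists t, i; split=> //;
    solve [lia | by left | by right].
Qed.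

Lemma match_edgesP e : e \in match_edges ->
  exists t i, [/\ t < K, 0 < i <= k./2 & e = (cut t - i, cut t + (k - i))].
Proof.
by move=> /allpairsP [[t i]] /=; rewrite !mem_iota => -[ht hi ->];
  exists t, i; split=> //; lia.
Qed.

Lemma link_edgesP m e : e \in link_edges m ->
  exists2 t, t.+1 < 2 * m & e = (cut t, cut t + k).
Proof.
move=> /mapP [j]; rewrite mem_iota => hj ->.
by exists (2 * j); rewrite ?cutS //; lia.
Qed.

Lemma uniq_star_edges : uniq star_edges.
Proof.
rewrite cat_uniq; apply/and3P; split.
- apply: allpairs_uniq; rewrite ?iota_uniq // => -[t i] [t' i'].
  move=> /allpairsP[[a b] [/= ha hb [-> ->]]].
  move=> /allpairsP[[a' b'] [/= ha' hb' [-> ->]]] [e2 e1].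
  move: hb hb'; rewrite !mem_iota => hb hb'.
  by move/cut_inj: e1 => ?; subst a'; move: e2; rewrite /cut => ?; congr (_, _);
    lia.
(* Modulo [k] the lower end [cut t - i] has residue [k./2 - i], while lower ends in the second list
   have residue [k./2]. *)
- apply/hasPn => e /allpairsP[[t i] [/= _ + ->]]; rewrite mem_iota => hi.
  apply/allpairsP => -[[t' i'] [/= _ + [e1 e2]]]; rewrite mem_iota => hi'.
  move: e1; rewrite /cut -addnBA; last lia.
  by move/euclid_inj => []; lia.
- apply: allpairs_uniq; rewrite ?iota_uniq // => -[t i] [t' i'].
  move=> /allpairsP[[a b] [/= ha hb [-> ->]]].
  move=> /allpairsP[[a' b'] [/= ha' hb' [-> ->]]] [e1 e2].
  move: hb hb'; rewrite !mem_iota => hb hb'.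
  by move/cut_inj: e1 => ?; subst a'; move: e2; rewrite /cut => ?; congr (_, _);
    lia.
Qed.

Lemma uniq_match_edges : uniq match_edges.
Proof.
apply: allpairs_uniq; rewrite ?iota_uniq // => -[t i] [t' i'].
move=> /allpairsP[[a b] [/= ha hb [-> ->]]].
move=> /allpairsP[[a' b'] [/= ha' hb' [-> ->]]] [e2 _].
move: hb hb' e2; rewrite !mem_iota /cut => hb hb'.
rewrite -!addnBA; try lia.
by move/euclid_inj => [] *; first lia; first lia; congr (_, _); lia.
Qed.

Lemma uniq_link_edges m : uniq (link_edges m).
Proof.
by rewrite map_inj_uniq ?iota_uniq // => i j [/cut_inj]; lia.
Qed.

Lemma touches_star v : touches v star_edges =
  \sum_(0 <= t < K) (2 * k./2) * (cut t == v) + touches v match_edges.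
Proof.
rewrite touches_cat /touches !big_allpairs_dep /= /index_iota subn0.
rewrite -!big_split /=; apply: eq_bigr => t _.
rewrite -big_split /= (eq_bigr (fun i => 2 * (cut t == v) +
  ((cut t - i == v) + (cut t + (k - i) == v)))); last by move=> i _; lia.
by rewrite big_split /= big_const_seq count_predT size_iota iter_addn; lia.
Qed.

Lemma touches_link m v :
  touches v (link_edges m) = \sum_(0 <= t < 2 * m) 1 * (cut t == v).
Proof.
rewrite touches_map /=; elim: m => [|m IH]; first by rewrite big_nil big_geq.
rewrite (_ : iota 0 m.+1 = iota 0 m ++ [:: m]); last by rewrite -addn1 iotaD.
rewrite big_cat IH /= big_seq1 (_ : 2 * m.+1 = (2 * m).+2); last by lia.
by rewrite !big_nat_recr //=; lia.
Qed.

Lemma rank_cut t : t < K -> rank n (cut t) = 2 * (k * t) + (2 * k./2 + 1).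
Proof. by move=> /cut_bound; rewrite /rank /cut; lia_if. Qed.

Lemma cut_eq t v : t < K -> v < n ->
  (cut t == v) = (rank n v == 2 * (k * t) + (2 * k./2 + 1)).
Proof.
move=> tK vn; rewrite -rank_cut //; apply/eqP/eqP => [->|] //.
move/esym; apply: rank_inj => //; have := cut_bound tK; lia.
Qed.

(** [m] is the number of linked pairs of cuts, [extra] the gain from corrections near the top. *)
Definition total_degree (m : nat) (extra : nat -> nat) (v : nat) : nat :=
  base_degree v + \sum_(0 <= t < K) (2 * k./2) * (cut t == v)
  + \sum_(0 <= t < 2 * m) 1 * (cut t == v) + extra v.

(** A raised edge must have base at most [K], unless a label is spare, and a lowered one base at
    least 1. Star and link edges stay below the top threshold; match edges reach the first one. *)
Lemma corrected_has_labelling (s m : nat) (PX NX : seq (nat * nat))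
    (extra : nat -> nat) :
  K.+1 < s -> 2 * m <= K ->
  edge_list n k PX -> edge_list n k NX -> uniq PX -> uniq NX ->
  (forall e, e \in PX -> k * K <= e.1 \/ k * K + k./2 <= e.2) ->
  (forall e, e \in NX -> e.2 < e.1 + k \/ k * K + k./2 <= e.2) ->
  (forall e, e \in PX -> K.+2 < s \/ rank n e.1 + rank n e.2 < 4 * (k * K) + w) ->
  (forall e, e \in NX -> (0 < K /\ 2 * k + 2 <= rank n e.1 + rank n e.2) \/
     4 * (k * K) + w <= rank n e.1 + rank n e.2) ->
  (forall v, touches v PX = extra v + touches v NX) ->
  (forall x y, x < n -> y < n ->
     total_degree m extra x = total_degree m extra y -> x = y) ->
  has_irregular_labelling (cycle_power n k) s.
Proof.
move=> Ks mK ePX eNX uPX uNX sP sN bP bN tX inj.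
apply: (@corrected_labelling n k s (base)
  ((star_edges ++ link_edges m) ++ PX) (match_edges ++ NX)
  (total_degree m extra)) => //.
- by move=> x y; rewrite /base addnC.
- by move=> x y; apply: leq_ltn_trans (level_le _ _ _ _) Ks.
- apply/allP => e; rewrite mem_cat => /orP[|/(allP ePX) //].
  rewrite mem_cat => /orP[].
    move=> /star_edgesP [t [i [/cut_bound tK hi [] ->]]] /=;
    by rewrite /cut in tK *; lia.
  by move=> /link_edgesP [t ht ->]; have := @cut_bound t; rewrite /=; lia.
- apply/allP => e; rewrite mem_cat => /orP[|/(allP eNX) //].
  move=> /match_edgesP [t [i [/cut_bound tK hi ->]]] /=.
  by rewrite /cut in tK *; lia.
- rewrite cat_uniq uPX andbT cat_uniq uniq_star_edges uniq_link_edges /= andbT.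
  apply/andP; split; apply/hasPn => e.
    (* A link edge spans exactly [k] positions, a star edge fewer. *)
    move=> /link_edgesP [t ht ->]; apply/negP.
    by move=> /star_edgesP [t' [i [_ hi [] [e1 e2]]]]; lia.
  move=> /sP h; apply/negP; rewrite mem_cat => /orP[].
    move=> /star_edgesP [t [i [tK hi E]]]; have := cut_bound tK.
    by case: E h => -> /=; rewrite /cut; lia.
  move=> /link_edgesP [t ht E]; have := @cut_bound t.+1.
  by rewrite cutS; move: h; rewrite E /= /cut; lia.
- rewrite cat_uniq uNX uniq_match_edges /= andbT; apply/hasPn => e /sN h.
  apply/negP => /match_edgesP [t [i [/cut_bound tK hi E]]].
  by move: tK h; rewrite E /= /cut; lia.
- move=> e ePe; suff [h|h] : K.+2 < s \/ rank n e.1 + rank n e.2 < 4 * (k * K) + w.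
  + by apply: leq_ltn_trans h; rewrite ltnS level_le.
  + by apply: leq_ltn_trans Ks; rewrite ltnS level_lt.
  move: ePe; rewrite mem_cat => /orP[|/bP //]; rewrite mem_cat => /orP[].
  + move=> /star_edgesP [t [i [tK hi E]]]; right.
    have := cut_bound tK; have := rank_cut tK.
    by case: E => -> /=; rewrite /rank /cut; lia_if.
  + move=> /link_edgesP [t ht ->]; right => /=; have tK : t.+1 < K by lia.
    rewrite -cutS !rank_cut //; last lia.
    by have := cut_bound tK; rewrite /cut mulnS; lia.
- move=> e; rewrite mem_cat => /orP[|/bN /level_gt0 //].
  move=> /match_edgesP [t [i [tK hi ->]]] /=; apply: level_gt0; left; split;
    first lia.
  by have := cut_bound tK; rewrite /rank /cut; lia_if.
- move=> v vn; rewrite (touches_cat v (star_edges ++ _)) (touches_cat v star_edges).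
  rewrite (touches_cat v match_edges) touches_star touches_link tX.
  rewrite /total_degree /base_degree.
  lia.
Qed.

Lemma total_degree0 (m : nat) (extra : nat -> nat) (v : nat) :
  2 * m <= K -> v < n -> rank n v = 0 ->
  total_degree m extra v = extra v.
Proof.
move=> mK vn rv; rewrite /total_degree (base_degree0) //.
have H t : t < K -> (cut t == v) = false.
  by move=> tK; rewrite cut_eq // rv; lia.
rewrite (@sum_pred_at _ K _ (fun t => cut t == v)); last first.
  by move=> t tK; rewrite H //; lia.
rewrite (@sum_pred_at _ K _ (fun t => cut t == v)); last first.
  by move=> t tK; rewrite H //; lia.
lia.
Qed.

Lemma total_degree_top (m : nat) (extra : nat -> nat) (v r : nat) :
  2 * m <= K -> v < n -> 0 < r < w -> rank n v = 2 * (k * K) + r ->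
  total_degree m extra v = 2 * (k * K) + (r - (w <= 2 * r)) + extra v.
Proof.
move=> mK vn hr rv; rewrite /total_degree (base_degree_top vn hr rv).
have H t : t < K -> (cut t == v) = false.
  move=> tK; have : k * t + k <= k * K by rewrite -mulnSr leq_mul2l tK orbT.
  by rewrite cut_eq // rv; lia.
rewrite (@sum_pred_at _ K _ (fun t => cut t == v)); last first.
  by move=> t tK; rewrite H //; lia.
rewrite (@sum_pred_at _ K _ (fun t => cut t == v)); last first.
  by move=> t tK; rewrite H //; lia.
lia.
Qed.

Lemma total_degree_block (m : nat) (extra : nat -> nat) (v q r : nat) :
  2 * m <= K -> v < n -> q < K -> 0 < r <= 2 * k -> rank n v = 2 * (k * q) + r ->
  total_degree m extra v =
  2 * (k * q) + (r - (k < r)) +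
  (r == 2 * k./2 + 1) * (2 * k./2 + (q < 2 * m)) + extra v.
Proof.
move=> mK vn qK hr rv.
rewrite /total_degree (base_degree_block vn qK hr rv).
case: (eqVneq r (2 * k./2 + 1)) => hrk.
  have H t : t < K -> (cut t == v) = (t == q).
    move=> tK; rewrite cut_eq // rv hrk eqn_add2r !eqn_mul2l /=.
    by rewrite (_ : k == 0 = false) //; lia.
  rewrite (@sum_pred_at _ q _ (fun t => cut t == v)) //.
  rewrite (@sum_pred_at _ q _ (fun t => cut t == v)); last by move=> t ?;
    rewrite H //; lia.
  lia.
have H t : t < K -> (cut t == v) = false.
  move=> tK; rewrite cut_eq // rv; apply/negP => /eqP E.
  have E2 : (2 * k) * q + r.-1 = (2 * k) * t + 2 * k./2 by lia.
  by have [] := euclid_inj _ _ E2; lia.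
rewrite (@sum_pred_at _ K _ (fun t => cut t == v)); last first.
  by move=> t tK; rewrite H //; lia.
rewrite (@sum_pred_at _ K _ (fun t => cut t == v)); last first.
  by move=> t tK; rewrite H //; lia.
lia.
Qed.

(** * Injectivity of the corrected degrees *)

Lemma rank_cases (r : nat) : r < n ->
  [\/ r = 0,
      exists q r', [/\ q < K, 0 < r' <= 2 * k & r = 2 * (k * q) + r'] |
      exists2 r', 0 < r' < w & r = 2 * (k * K) + r'].
Proof.
move=> rn; case: (posnP r) => [|r0]; first by constructor 1.
case: (leqP r (2 * (k * K))) => h; last first.
  by constructor 3; exists (r - 2 * (k * K)); lia.
constructor 2; exists (r.-1 %/ (2 * k)), (r.-1 %% (2 * k)).+1.
have := divn_eq r.-1 (2 * k); have : r.-1 %% (2 * k) < 2 * k by rewrite ltn_mod;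
  lia.
by rewrite ltn_divLR; [split; lia | lia].
Qed.

(* With [z] set, the vertex of rank [2kK] takes over the value [2kK] that is
   otherwise reached by the last cut vertex. *)
Definition block_value (z : bool) (r : nat) : nat :=
  r - (k < r) + (r == 2 * k./2 + 1) * (k - z) + ((r == 2 * k) && z).

Lemma block_value_range (z : bool) (r : nat) :
  0 < r <= 2 * k -> 0 < block_value z r <= 2 * k.
Proof.
rewrite /block_value; case: (ltnP k r); case: (eqVneq r (2 * k)) => ?;
case: (eqVneq r (2 * k./2 + 1)) => ?; case: z => /=;
rewrite ?mul1n ?mul0n ?addn0; lia.
Qed.

Lemma block_value_inj (z : bool) (r r' : nat) :
  0 < r < r' -> r' <= 2 * k -> block_value z r != block_value z r'.
Proof.
rewrite /block_value => h h'.
case: (eqVneq r (2 * k./2 + 1)) => ?; case: (eqVneq r' (2 * k./2 + 1)) => ?;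
case: (eqVneq r' (2 * k)) => ?; case: (eqVneq r (2 * k)) => ?;
case: (ltnP k r) => ?; case: (ltnP k r') => ?; case: z => /=;
rewrite ?mul1n ?mul0n ?addn0; lia.
Qed.

(* The bounds on [rs] say that it is one of the two top ranks of equal degree. *)
Lemma zigzag_inj (F : nat -> nat) (z : bool) (rs c : nat) :
  (forall v, v < n -> rank n v = 0 -> F v = 0) ->
  (forall v q r, v < n -> q < K -> 0 < r <= 2 * k ->
     rank n v = 2 * (k * q) + r ->
     F v = 2 * (k * q) + block_value (z && (q.+1 == K)) r) ->
  (forall v r, v < n -> 0 < r < w -> rank n v = 2 * (k * K) + r ->
     F v = 2 * (k * K) + (r - (w <= 2 * r)) + (r == rs) * c) ->
  w <= 2 * rs + 2 -> 2 * rs <= w + 1 -> 0 < rs < w ->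
  w <= rs - (w <= 2 * rs) + c + 1 ->
  forall x y, x < n -> y < n -> F x = F y -> x = y.
Proof.
move=> F0 Fb Ft rs1 rs2 rs3 hc.
suff W x y : x < n -> y < n -> rank n x < rank n y -> F x != F y.
  move=> x y xn yn E; apply: (rank_inj xn yn).
  case: (ltngtP (rank n x) (rank n y)) => // h.
    by have := W x y xn yn h; rewrite E eqxx.
  by have := W y x yn xn h; rewrite E eqxx.
have top_pos r : 0 < r < w -> 0 < r - (w <= 2 * r) + (r == rs) * c.
  by move=> ?; case: (eqVneq r rs) => ?; rewrite ?mul1n ?mul0n; lia.
move=> xn yn.
case: (rank_cases (rank_lt xn)) => [hx|[q [r [qK hr hx]]]|[r hr hx]];
case: (rank_cases (rank_lt yn)) => [hy|[q' [r' [qK' hr' hy]]]|[r' hr' hy]];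
rewrite hx hy => hxy.
- by [].
- rewrite (F0 x xn hx) (Fb y q' r' yn qK' hr' hy).
  by have := block_value_range (z && (q'.+1 == K)) hr'; lia.
- by rewrite (F0 x xn hx) (Ft y r' yn hr' hy) -addnA; have := top_pos r' hr'; lia.
- lia.
- rewrite (Fb x q r xn qK hr hx) (Fb y q' r' yn qK' hr' hy).
  have := block_value_range (z && (q.+1 == K)) hr.
  have := block_value_range (z && (q'.+1 == K)) hr'.
  case: (ltngtP q q') hxy => qq hxy.
  + have : k * q + k <= k * q' by rewrite -mulnSr leq_mul2l qq orbT.
    lia.
  + have : k * q' + k <= k * q by rewrite -mulnSr leq_mul2l qq orbT.
    lia.
  + by rewrite qq eqn_add2l => _ _; apply: block_value_inj; lia.
- have : k * q + k <= k * K by rewrite -mulnSr leq_mul2l qK orbT.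
  rewrite (Fb x q r xn qK hr hx) (Ft y r' yn hr' hy) -addnA.
  have := block_value_range (z && (q.+1 == K)) hr; have := top_pos r' hr'.
  lia.
- lia.
- have : k * q' + k <= k * K by rewrite -mulnSr leq_mul2l qK' orbT.
  lia.
(* Unraised top offsets are at most [w-2], and [hc] lifts the raised one to at least [w-1]. *)
- rewrite (Ft x r xn hr hx) (Ft y r' yn hr' hy).
  case: (eqVneq r rs) => ?; case: (eqVneq r' rs) => ?; rewrite ?mul1n ?mul0n; lia.
Qed.

(* The third conditions here and below keep [e] out of [star_edges],
   [link_edges], resp. [match_edges]. *)
Definition plus_edge (s : nat) (e : nat * nat) : Prop :=
  [/\ e.1 < e.2 <= e.1 + k, e.2 < n, k * K <= e.1 \/ k * K + k./2 <= e.2 &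
      K.+2 < s \/ rank n e.1 + rank n e.2 < 4 * (k * K) + w].

Definition minus_edge (e : nat * nat) : Prop :=
  [/\ e.1 < e.2 <= e.1 + k, e.2 < n, e.2 < e.1 + k \/ k * K + k./2 <= e.2 &
      (0 < K /\ 2 * k + 2 <= rank n e.1 + rank n e.2) \/
      4 * (k * K) + w <= rank n e.1 + rank n e.2].

Lemma top_correction (s m : nat) (PX NX : seq (nat * nat)) (extra : nat -> nat)
    (z : bool) (rs c : nat) :
  K.+1 < s -> 2 * m <= K -> uniq PX -> uniq NX ->
  (forall e, e \in PX -> plus_edge s e) -> (forall e, e \in NX -> minus_edge e) ->
  (forall v, touches v PX = extra v + touches v NX) ->
  (forall v, v < n -> rank n v = 0 -> extra v = 0) ->
  (forall v q r, v < n -> q < K -> 0 < r <= 2 * k ->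
     rank n v = 2 * (k * q) + r ->
     r - (k < r) + (r == 2 * k./2 + 1) * (2 * k./2 + (q < 2 * m)) + extra v =
     block_value (z && (q.+1 == K)) r) ->
  (forall v r, v < n -> 0 < r < w -> rank n v = 2 * (k * K) + r ->
     extra v = (r == rs) * c) ->
  w <= 2 * rs + 2 -> 2 * rs <= w + 1 -> 0 < rs < w ->
  w <= rs - (w <= 2 * rs) + c + 1 ->
  has_irregular_labelling (cycle_power n k) s.
Proof.
move=> Ks mK uP uN hP hN tX x0 xb xt rs1 rs2 rs3 hc.
apply: (corrected_has_labelling Ks mK _ _ uP uN) tX _.
- by apply/allP => e /hP [] /andP[-> ->] ->.
- by apply/allP => e /hN [] /andP[-> ->] ->.
- by move=> e /hP [].
- by move=> e /hN [].
- by move=> e /hP [].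
- by move=> e /hN [].
- apply: (zigzag_inj (z := z) _ _ _ rs1 rs2 rs3 hc).
  + by move=> v vn rv; rewrite total_degree0 ?x0.
  + move=> v q r vn qK hr rv.
    by rewrite (total_degree_block _ mK vn qK hr rv) -(xb v q r) // !addnA.
  + by move=> v r vn hr rv; rewrite (total_degree_top _ mK vn hr rv) (xt v r).
Qed.

Lemma position_eq (p v : nat) : p < n -> v < n ->
  (p == v) = (rank n v == rank n p).
Proof.
by move=> pn vn; apply/eqP/eqP => [->|/esym] //; apply: rank_inj.
Qed.

(** The interface for the constructions below: [p], one of the top coincidence, gains [c], and a
    vertex [a] of the last block may gain [b], which settles a last cut left without a partner. *)
Lemma raise_top (s m : nat) (PX NX : seq (nat * nat)) (z : bool)
    (p rs c a ra b : nat) :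
  K.+1 < s -> 2 * m <= K -> uniq PX -> uniq NX ->
  (forall e, e \in PX -> plus_edge s e) -> (forall e, e \in NX -> minus_edge e) ->
  (forall v, touches v PX = c * (p == v) + b * (a == v) + touches v NX) ->
  p < n -> rank n p = 2 * (k * K) + rs ->
  (0 < b -> [/\ 0 < K, a < n, rank n a + 2 * k = 2 * (k * K) + ra &
                0 < ra <= 2 * k]) ->
  (forall q r, q < K -> 0 < r <= 2 * k ->
     r - (k < r) + (r == 2 * k./2 + 1) * (2 * k./2 + (q < 2 * m))
       + b * ((q.+1 == K) && (r == ra)) =
     block_value (z && (q.+1 == K)) r) ->
  w <= 2 * rs + 2 -> 2 * rs <= w + 1 -> 0 < rs < w ->
  w <= rs - (w <= 2 * rs) + c + 1 ->
  has_irregular_labelling (cycle_power n k) s.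
Proof.
move=> Ks mK uP uN hP hN tX pn rp ha hb rs1 rs2 rs3 hc.
apply: (top_correction (z := z) Ks mK uP uN hP hN tX _ _ _ rs1 rs2 rs3 hc).
- move=> v vn rv; rewrite (position_eq pn vn) rp rv (_ : _ == _ = false); last lia.
  rewrite muln0; case: (posnP b) => [->|/ha [K0 an ra1 ra2]];
    first by rewrite mul0n.
  have kK : k <= k * K by rewrite leq_pmulr.
  rewrite (position_eq an vn) rv (_ : _ == _ = false) ?muln0 //; lia.
- move=> v q r vn qK hr rv; rewrite -(hb q r qK hr) addnA.
  have Kq : k * q + k <= k * K by rewrite -mulnSr leq_mul2l qK orbT.
  rewrite (position_eq pn vn) rp rv (_ : (2 *
    (k * q) + r == _) = false) ?muln0 ?addn0; last lia.
  congr (_ + _); case: (posnP b) => [->|/ha [K0 an ra1 ra2]];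
    first by rewrite !mul0n.
  congr (_ * nat_of_bool _); rewrite (position_eq an vn) rv.
  apply/eqP/andP => [E|[/eqP qE /eqP ->]]; last first.
    by move: ra1; rewrite -qE mulnS; lia.
  have E2 : (2 * k) * q.+1 + r.-1 = (2 * k) * K + ra.-1 by rewrite mulnS; lia.
  by have [] := euclid_inj _ _ E2; lia.
- move=> v r vn hr rv; rewrite (position_eq pn vn) rp rv eqn_add2l mulnC.
  case: (posnP b) => [->|/ha [K0 an ra1 ra2]]; first by rewrite mul0n addn0.
  by rewrite (position_eq an vn) rv (_ : _ == rank n a = false) ?muln0 ?addn0 //;
    lia.
Qed.

(** * Repairing the topmost coincidence *)

(* Among the two vertices of equal degree above rank [2kK], the one of even rank;
   for [w = 2] there is no second one, and rank 1 has to give up the value [2kK]. *)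
Definition top_offset : nat := maxn 1 (uphalf w)./2.
Definition top_vertex : nat := k * K + w - 1 - top_offset.
Definition top_rank : nat := if w == 2 then 1 else 2 * top_offset.

Lemma top_vertex_lt : top_vertex < n.
Proof. by rewrite /top_vertex; lia. Qed.

Lemma rank_top_vertex : rank n top_vertex = 2 * (k * K) + top_rank.
Proof. by rewrite /rank /top_vertex /top_rank /top_offset; lia_if. Qed.

(** The last bound says that a gain of [w./2] lifts [top_vertex] past all others. *)
Lemma top_rank_bounds :
  [/\ w <= 2 * top_rank + 2, 2 * top_rank <= w + 1, 0 < top_rank < w &
      w <= top_rank - (w <= 2 * top_rank) + w./2 + 1].
Proof. by rewrite /top_rank /top_offset; case: eqP => ?; split; lia. Qed.

Lemma top_offset_bounds :
  [/\ 0 < top_offset, 4 * top_offset <= w + 1 \/ w = 2 /\ top_offset = 1,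
      w <= 4 * top_offset + 2 & top_vertex + top_offset = k * K + w - 1].
Proof. by rewrite /top_vertex /top_offset; split; lia. Qed.

(** The [k./2] triangles use the positions [p+1, ..., p+k], whose ranks are low enough to keep the
    raised edges below the top threshold. The gain [k] is at least [w./2]. *)
Lemma even_labelling : ~~ odd k -> 0 < K ->
  has_irregular_labelling (cycle_power n k) K.+2.
Proof.
move=> ek K0; have kK : k <= k * K by rewrite leq_pmulr.
have [rs1 rs2 rs3 rs4] := top_rank_bounds.
have [d1 d2 d3 pd] := top_offset_bounds.
set p := top_vertex in pd *.
have kE : k = 2 * k./2 by lia.
apply: (raise_top (s := K.+2) (m := 0)
  (PX := fan_plus p (fun i => p + i) (fun i => p + (k + 1 - i)) (iota 1 k./2))
  (NX := fan_minus (fun i => p + i) (fun i => p + (k + 1 - i)) (iota 1 k./2))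
  (z := false) (p := p) (c := k) (a := 0) (ra := 0) (b := 0)
  _ _ _ _ _ _ _ top_vertex_lt rank_top_vertex _ _ rs1 rs2 rs3) => //.
- clear ek rs1 rs2 rs3 rs4; apply: uniq_fan_plus; rewrite ?iota_uniq // => i j;
    rewrite !mem_iota; lia.
- clear ek rs1 rs2 rs3 rs4; apply: uniq_fan_minus; rewrite ?iota_uniq // => i j;
    rewrite !mem_iota => hi hj []; lia.
- clear ek rs1 rs2 rs3 rs4; move=> e /fan_plusP[i]; rewrite mem_iota => hi [] -> ;
    split=> /=; rewrite /rank; lia_if.
- clear ek rs1 rs2 rs3 rs4; move=> e /mapP[i]; rewrite mem_iota => hi ->;
    split=> /=; rewrite /rank; lia_if.
- by move=> v; rewrite touches_fan size_iota; case: eqVneq; lia.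
- by move=> q r qK hr; rewrite /block_value; case: eqVneq => ?;
    rewrite ?mul1n ?mul0n; lia.
- lia.
Qed.

(** All [K] cuts are linked in pairs. The triangles on [p+1, ..., p+k-1] give the gain [k-1], enough
    since [w < 2k]. *)
Lemma odd_even_labelling : odd k -> ~~ odd K -> 0 < K -> w < 2 * k ->
  has_irregular_labelling (cycle_power n k) K.+2.
Proof.
move=> ok eK K0 w2k; have kK : k <= k * K by rewrite leq_pmulr.
have [rs1 rs2 rs3 rs4] := top_rank_bounds.
have [d1 d2 d3 pd] := top_offset_bounds.
set p := top_vertex in pd *.
have kE : k = 2 * k./2 + 1 by lia.
apply: (raise_top (s := K.+2) (m := K./2)
  (PX := fan_plus p (fun i => p + i) (fun i => p + (k - i)) (iota 1 k./2))
  (NX := fan_minus (fun i => p + i) (fun i => p + (k - i)) (iota 1 k./2))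
  (z := false) (p := p) (c := k.-1) (a := 0) (ra := 0) (b := 0)
  _ _ _ _ _ _ _ top_vertex_lt rank_top_vertex _ _ rs1 rs2 rs3) => //.
- lia.
- clear ok eK rs1 rs2 rs3 rs4; apply: uniq_fan_plus; rewrite ?iota_uniq // => i j;
    rewrite !mem_iota; lia.
- clear ok eK rs1 rs2 rs3 rs4; apply: uniq_fan_minus; rewrite ?iota_uniq // => i j;
    rewrite !mem_iota => hi hj []; lia.
- clear ok eK rs1 rs2 rs3 rs4; move=> e /fan_plusP[i];
    rewrite mem_iota => hi [] ->; split=> /=;
    rewrite /rank; lia_if.
- clear ok eK rs1 rs2 rs3 rs4; move=> e /mapP[i]; rewrite mem_iota => hi ->;
    split=> /=;
    rewrite /rank; lia_if.
- by move=> v; rewrite touches_fan size_iota; case: eqVneq; lia.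
- by move=> q r qK hr; rewrite /block_value; case: eqVneq => ?;
    rewrite ?mul1n ?mul0n; lia.
- lia.
Qed.

(* Here [v] must receive the value [2k(K+1)], that is, all its labels are
   maximal; the five-cycle [v, v-k, v-2, v+1, v+k] provides the last two units. *)
Lemma odd_even_full_labelling : odd k -> ~~ odd K -> 0 < K -> w = 2 * k ->
  has_irregular_labelling (cycle_power n k) K.+2.
Proof.
move=> ok eK K0 w2k; have kK : k <= k * K by rewrite leq_pmulr.
set v := k * K + k./2.
apply: (raise_top (s := K.+2) (m := K./2)
  (PX := fan_plus v (fun i => v - i) (fun i => v - (k - i)) (iota 1 k./2)
     ++ [:: pair_minmax (v - k) v; pair_minmax (v - 2) (v + 1);
         pair_minmax v (v + k)])
  (NX := fan_minus (fun i => v - i) (fun i => v - (k - i)) (iota 1 k./2)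
     ++ [:: pair_minmax (v - k) (v - 2); pair_minmax (v + 1) (v + k)])
  (z := false) (p := v) (rs := k) (c := k.+1) (a := 0) (ra := 0) (b := 0)) => //.
- lia.
- rewrite cat_uniq; apply/and3P; split.
  + apply: uniq_fan_plus; rewrite ?iota_uniq // => i j; rewrite !mem_iota; lia.
  + apply/hasPn => e; rewrite !inE => /or3P[] /eqP->; apply/negP;
      move=> /fan_plusP[i]; rewrite mem_iota /v => hi [] []; lia.
  + by rewrite /= !inE /pair_minmax /v /eq_op /=; lia.
- rewrite cat_uniq; apply/and3P; split.
  + apply: uniq_fan_minus; rewrite ?iota_uniq // => i j;
      rewrite !mem_iota => hi hj []; lia.
  + apply/hasPn => e; rewrite !inE => /orP[] /eqP->; apply/negP;
      move=> /mapP[i]; rewrite mem_iota /v => hi []; lia.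
  + by rewrite /= !inE /pair_minmax /v /eq_op /=; lia.
- move=> e; rewrite mem_cat => /orP[].
    move=> /fan_plusP[i]; rewrite mem_iota => hi [] ->; split=> /=;
    rewrite /rank /v; lia_if.
  by rewrite !inE => /or3P[] /eqP->; split=> /=; rewrite /rank /v; lia_if.
- move=> e; rewrite mem_cat => /orP[].
    move=> /mapP[i]; rewrite mem_iota => hi ->; split=> /=;
    rewrite /rank /v; lia_if.
  by rewrite !inE => /orP[] /eqP->; split=> /=; rewrite /rank /v; lia_if.
- move=> x; rewrite (touches_cat x (fan_plus _ _ _ _)) (touches_cat x
    (fan_minus _ _ _)) touches_fan size_iota !touches_minmax.
  by case: (v == x); lia.
- by rewrite /v; lia.
- by rewrite /rank /v; lia_if.
- by move=> q r qK hr; rewrite /block_value; case: eqVneq => ?;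
    rewrite ?mul1n ?mul0n; lia.
- lia.
- lia.
- lia.
- lia.
Qed.

(** An odd number of cuts leaves the last one, [v - k], unpaired. It is linked to [v], where the
    next cut would be, and the raised edge gives both their odd unit. *)
Lemma odd_odd_high_labelling : odd k -> odd K -> 2 * k <= w.+1 ->
  has_irregular_labelling (cycle_power n k) K.+2.
Proof.
move=> ok oK w2k; have kK : k <= k * K by rewrite leq_pmulr //; lia.
set v := k * K + k./2.
apply: (raise_top (s := K.+2) (m := K./2)
  (PX := fan_plus v (fun i => v - i) (fun i => v - (k - i)) (iota 1 k./2)
     ++ [:: pair_minmax (v - k) v])
  (NX := fan_minus (fun i => v - i) (fun i => v - (k - i)) (iota 1 k./2))
  (z := false) (p := v) (rs := k) (c := k) (a := v - k) (ra := k) (b := 1)) => //.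
- lia.
- rewrite cat_uniq; apply/and3P; split=> //.
  + apply: uniq_fan_plus; rewrite ?iota_uniq // => i j; rewrite !mem_iota; lia.
  + apply/hasPn => e; rewrite !inE => /eqP->; apply/negP;
      move=> /fan_plusP[i]; rewrite mem_iota /v => hi [] []; lia.
- apply: uniq_fan_minus; rewrite ?iota_uniq // => i j;
    rewrite !mem_iota => hi hj []; lia.
- move=> e; rewrite mem_cat => /orP[].
    move=> /fan_plusP[i]; rewrite mem_iota => hi [] ->; split=> /=;
    rewrite /rank /v; lia_if.
  by rewrite !inE => /eqP->; split=> /=; rewrite /rank /v; lia_if.
- move=> e /mapP[i]; rewrite mem_iota => hi ->; split=> /=;
    rewrite /rank /v; lia_if.
- move=> x; rewrite (touches_cat x
    (fan_plus _ _ _ _)) touches_fan size_iota !touches_minmax.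
  by rewrite touches_nil; case: (v == x); lia.
- by rewrite /v; lia.
- by rewrite /rank /v; lia_if.
- by move=> _; split; rewrite /rank /v; lia_if.
- by move=> q r qK hr; rewrite /block_value; case: eqVneq => ?;
    rewrite ?mul1n ?mul0n; lia.
- lia.
- lia.
- lia.
- lia.
Qed.

Lemma size_skip
  (d h : nat) : 0 < d <= h -> size [seq i <- iota 1 h | i != d] = h.-1.
Proof.
move=> hd; rewrite size_filter -[LHS]/(count (predC (pred1 d)) _).
have := count_predC (pred1 d) (iota 1 h).
rewrite size_iota count_uniq_mem ?iota_uniq // mem_iota.
by rewrite (_ : (_ <= d < _) = true); lia.
Qed.

(** The unpaired last cut only reaches [2kK-1], the degree of the vertex [p + d] of rank [2kK].
    Raising the edge from [p] to [p + d] moves the latter to [2kK]; the triangle through [p + d] is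
    dropped to free this edge. *)
Lemma odd_odd_low_labelling : odd k -> odd K -> w.+1 < 2 * k ->
  has_irregular_labelling (cycle_power n k) K.+2.
Proof.
move=> ok oK w2k; have kK : k <= k * K by rewrite leq_pmulr //; lia.
have [rs1 rs2 rs3 rs4] := top_rank_bounds.
have [d1 d2 d3 pd] := top_offset_bounds.
set p := top_vertex in pd *; set d := top_offset in d1 d2 d3 pd *.
have kE : k = 2 * k./2 + 1 by lia.
have hd : 0 < d <= k./2 by lia.
(* One extra triangle exactly when [w = 2k-2]: only then is the gain [k-2] below [w./2]. *)
set J := nseq (w.+2 == 2 * k) 0.
have JP i : i \in J -> w.+2 = 2 * k by rewrite mem_nseq lt0b => /andP[/eqP].
have dJ : w.+2 = 2 * k -> d = k./2 by lia.
apply: (raise_top (s := K.+2) (m := K./2)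
  (PX := (fan_plus p (fun i => p + i) (fun i => p +
    (k - i)) [seq i <- iota 1 k./2 | i != d]
     ++ [:: pair_minmax p (p + d)]) ++ fan_plus p (fun=> p - (k - 1))
         (fun=> p - k) J)
  (NX := fan_minus (fun i => p + i) (fun i => p +
    (k - i)) [seq i <- iota 1 k./2 | i != d]
     ++ fan_minus (fun=> p - (k - 1)) (fun=> p - k) J)
  (z := true) (p := p) (c := k - 2 + 2 * (w.+2 == 2 * k)) (a := p + d)
    (ra := 2 * k) (b := 1)
  _ _ _ _ _ _ _ top_vertex_lt rank_top_vertex _ _ rs1 rs2 rs3) => //.
- lia.
- clear ok oK rs1 rs2 rs3 rs4; rewrite cat_uniq cat_uniq; apply/and3P; split=> //;
    first (apply/and3P; split=> //).
  + apply: uniq_fan_plus; rewrite ?filter_uniq ?iota_uniq // => i j;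
      rewrite !mem_filter !mem_iota; lia.
  + apply/hasPn => e; rewrite !inE => /eqP->; apply/negP;
      move=> /fan_plusP[i]; rewrite mem_filter mem_iota => hi [] []; lia.
  + apply/hasPn => e /fan_plusP[i /JP /dJ hJ E]; apply/negP;
      rewrite mem_cat => /orP[].
      by move=> /fan_plusP[j]; rewrite mem_filter mem_iota => hj E'; move: E;
        case: E' => -> [] []; lia.
    by rewrite inE => /eqP E'; move: E; rewrite E' => -[] []; lia.
  + apply: uniq_fan_plus => [|i j|i j|i j]; rewrite /J; case: eqP => // hJ;
      rewrite ?inE; lia.
- clear ok oK rs1 rs2 rs3 rs4; rewrite cat_uniq; apply/and3P; split=> //.
  + apply: uniq_fan_minus; rewrite ?filter_uniq ?iota_uniq // => i j;
      rewrite !mem_filter !mem_iota => hi hj []; lia.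
  + apply/hasPn => e /mapP[i /JP /dJ hJ ->]; apply/negP => /mapP[j].
    by rewrite mem_filter mem_iota => hj []; lia.
  + by rewrite /J; case: eqP.
- clear ok oK rs1 rs2 rs3 rs4; move=> e; rewrite mem_cat => /orP[];
    first (rewrite mem_cat => /orP[]).
  + move=> /fan_plusP[i]; rewrite mem_filter mem_iota => hi [] ->; split=> /=;
    rewrite /rank; lia_if.
  + rewrite inE => /eqP ->; split=> /=;
    rewrite /rank; lia_if.
  + move=> /fan_plusP[i /JP hJ [] ->]; split=> /=;
    rewrite /rank; lia_if.
- clear ok oK rs1 rs2 rs3 rs4; move=> e; rewrite mem_cat => /orP[] /mapP[i].
  + rewrite mem_filter mem_iota => hi ->; split=> /=;
    rewrite /rank; lia_if.
  + move=> /JP hJ ->; split=> /=;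
    rewrite /rank; lia_if.
- clear ok oK rs1 rs2 rs3 rs4; move=> x;
    rewrite (touches_cat x (_ ++ _)) (touches_cat x (fan_plus _ _ _ _))
      (touches_cat x
        (fan_minus _ _ _)) !touches_fan size_skip // !touches_minmax size_nseq.
  by rewrite touches_nil; case: (p == x); lia.
- by move=> _; split; rewrite ?pd /rank; lia_if.
- move=> q r qK hr; rewrite /block_value (_ : q < 2 * K./2 = (q.+1 != K)); last lia.
  clear ok oK rs1 rs2 rs3 rs4.
  case: (q.+1 == K); case: (eqVneq r (2 * k)) => ?; case: eqVneq => ?;
    rewrite /= ?mul1n ?mul0n; lia.
- lia.
Qed.

(** With a spare label, edges above the top threshold can be raised too, so [v] is treated like a
    further cut. A gain of at least [k] is needed; for odd [k] the triangle from [J] brings it to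
    [k+1]. *)
Lemma exceptional_labelling : w = 2 * k + 1 -> (odd k ==> ~~ odd K) ->
  has_irregular_labelling (cycle_power n k) K.+3.
Proof.
move=> w2k oK.
set v := k * K + k./2; set J := nseq (odd k) 0.
have JP i : i \in J -> odd k by rewrite mem_nseq lt0b => /andP[].
apply: (raise_top (s := K.+3) (m := odd k * K./2)
  (PX := fan_plus v (fun i => v - i) (fun i => v + (k - i)) (iota 1 k./2)
     ++ fan_plus v (fun=> v + 1) (fun=> v + k) J)
  (NX := fan_minus (fun i => v - i) (fun i => v + (k - i)) (iota 1 k./2)
     ++ fan_minus (fun=> v + 1) (fun=> v + k) J)
  (z := false) (p := v) (rs := 2 * k./2 + 1) (c := 2 * k./2 + 2 * odd k)
  (a := 0) (ra := 0) (b := 0)) => //.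
- by case: (odd k); lia.
- rewrite cat_uniq; apply/and3P; split=> //.
  + apply: uniq_fan_plus; rewrite ?iota_uniq // => i j; rewrite !mem_iota; lia.
  + apply/hasPn => e /fan_plusP[i /JP hJ E]; apply/negP => /fan_plusP[j].
    by rewrite mem_iota => hj E'; move: E; case: E' => -> [] []; lia.
  + apply: uniq_fan_plus => [|i j|i j|i j]; rewrite /J; case: (odd k) => //;
      rewrite ?inE; lia.
- rewrite cat_uniq; apply/and3P; split=> //.
  + apply: uniq_fan_minus; rewrite ?iota_uniq // => i j;
      rewrite !mem_iota => hi hj []; lia.
  + apply/hasPn => e /mapP[i /JP hJ ->]; apply/negP => /mapP[j].
    by rewrite mem_iota => hj []; lia.
  + by rewrite /J; case: (odd k).
- move=> e; rewrite mem_cat => /orP[] /fan_plusP[i].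
  + by rewrite mem_iota => hi [] ->; split=> /=; rewrite ?/v; lia.
  + by move=> /JP hJ [] ->; split=> /=; rewrite ?/v; lia.
- move=> e; rewrite mem_cat => /orP[] /mapP[i].
  + rewrite mem_iota => hi ->; split=> /=; rewrite ?/v /rank;
      case: (posnP K) => K0; lia_if.
  + move=> /JP hJ ->; split=> /=; rewrite ?/v /rank; case: (posnP K) => K0; lia_if.
- move=> x; rewrite (touches_cat x (fan_plus _ _ _ _)) (touches_cat x
    (fan_minus _ _ _)) !touches_fan size_iota size_nseq.
  by case: (v == x); lia.
- by rewrite /v; lia.
- by rewrite /rank /v; lia_if.
- move=> q r qK hr; rewrite /block_value; case: eqVneq => ?; rewrite ?mul1n ?mul0n;
    last lia.
  by case: (boolP (odd k)) oK => /=; lia.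
- lia.
- lia.
- lia.
- lia.
Qed.

End Zigzag.

(** * The lower bound *)

Section LowerBound.

Variables (n k t : nat) (w : {set cycle_power n k} -> nat).
Hypotheses (kn : 2 * k < n) (wt : edge_labelling t w).

Lemma label_bounds (v y : 'I_n) :
  circulant_adj (iota 1 k) v y -> 1 <= w [set v; y] <= t.
Proof. by move=> vy; apply: wt; apply/edgesP; exists v, y. Qed.

Lemma sum_adj_const (v : 'I_n) (c : nat) :
  \sum_(y : 'I_n | circulant_adj (iota 1 k) v y) c = 2 * k * c.
Proof. by rewrite (sum_adj v (fun=> c) kn) sum_nat_const_nat; lia. Qed.

Lemma weighted_degree_bounds (v : 'I_n) :
  2 * k <= weighted_degree w v <= 2 * k * t.
Proof.
rewrite weighted_degreeE -{1}[2 * k]muln1 -!(sum_adj_const v).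
by apply/andP; split; apply: leq_sum => y /label_bounds /andP[].
Qed.

(** The other [2k-1] labels at [v] lie between 1 and [t]. *)
Lemma weighted_degree_edge (v y : 'I_n) : circulant_adj (iota 1 k) v y ->
  2 * k + w [set v; y] <= weighted_degree w v + 1 /\
  weighted_degree w v + t <= 2 * k * t + w [set v; y].
Proof.
move=> vy; rewrite weighted_degreeE -{1}[2 * k]muln1 -!(sum_adj_const v).
rewrite !(bigD1 y vy) /=.
have swap a b c d : b <= c -> a + b + d <= d + c + a by lia.
by split; apply: swap; apply: leq_sum => i /andP[/label_bounds /andP[]].
Qed.

Hypothesis inj : injective (weighted_degree w).

Lemma order_le : n + 2 * k <= 2 * k * t + 1.
Proof.
pose f (v : 'I_n) : 'I_(2 * k * t - 2 * k).+1 := inord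
  (weighted_degree w v - 2 * k).
have f_inj : injective f.
  move=> x y /(congr1 (@nat_of_ord _)).
  have := weighted_degree_bounds x; have := weighted_degree_bounds y => hy hx.
  by rewrite !inordK; try lia; move=> e; apply: inj; lia.
have := leq_card f f_inj; rewrite !card_ord.
by have := weighted_degree_bounds (Ordinal (leq_ltn_trans (leq0n _) kn)); lia.
Qed.

Hypothesis tight : n + 2 * k = 2 * k * t + 1.

Lemma weighted_degrees_tight :
  perm_eq [seq weighted_degree w v | v <- enum 'I_n] (iota (2 * k) n).
Proof.
have u : uniq [seq weighted_degree w v | v <- enum 'I_n].
  by rewrite (map_inj_uniq inj) enum_uniq.
have sub : {subset [seq weighted_degree w v | v <- enum 'I_n] <= iota (2 * k) n}.
  move=> d /mapP[v _ ->]; rewrite mem_iota.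
  by have := weighted_degree_bounds v; lia.
apply: uniq_perm; rewrite ?iota_uniq //.
have [] // := uniq_min_size u sub.
by rewrite size_iota size_map -cardE card_ord.
Qed.

Lemma sum_weighted_degrees_tight : 2 %| n * (2 * k) + 'C(n, 2).
Proof.
suff -> : n * (2 * k) + 'C(n, 2) = \sum_v weighted_degree w v.
  by rewrite handshake dvdn_mulr.
transitivity (\sum_(d <- iota (2 * k) n) d).
  rewrite -[X in iota X]addn0 iotaDl big_map big_split /= big_const_seq count_predT.
  by rewrite size_iota iter_addn_0 mulnC -bin2_sum /index_iota subn0.
by rewrite -(perm_big _ weighted_degrees_tight) big_map big_enum.
Qed.

Lemma tight_degree_exists (d : nat) : 2 * k <= d < 2 * k + n ->
  exists v : 'I_n, weighted_degree w v = d.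
Proof.
move=> hd; have : d \in iota (2 * k) n by rewrite mem_iota.
by rewrite -(perm_mem weighted_degrees_tight) => /mapP[v _ ->]; exists v.
Qed.

Lemma tight_complete : 0 < k -> n = 2 * k + 1 -> t != 2.
Proof.
move=> k0 nE; apply/eqP => t2.
have [x wx] : exists v : 'I_n, weighted_degree w v = 2 * k.
  by apply: tight_degree_exists; lia.
have [y wy] : exists v : 'I_n, weighted_degree w v = 4 * k.
  by apply: tight_degree_exists; lia.
have xy : circulant_adj (iota 1 k) x y.
  have nxy : (x : nat) != y.
    by apply/eqP => /val_inj E; move: wx wy; rewrite E; lia.
  have xn := ltn_ord x; have yn := ltn_ord y.
  (* The forward distance from [x] to [y]; if it exceeds [k], the backward distance [n - i] is at
     most [k]. *)
  pose i := if x < y then y - x else y + n - x.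
  rewrite cycle_power_adjE // mem_cat; apply/orP; case: (leqP i k) => hi.
    left; apply/mapP; exists i; first by move: hi; rewrite mem_iota /i; lia_if.
    by rewrite /cyc_next /i; lia_if.
  right; apply/mapP; exists (n - i); first by move: hi; rewrite mem_iota /i; lia_if.
  by rewrite /cyc_prev /i; lia_if.
have yx : circulant_adj (iota 1 k) y x by rewrite circulant_adj_sym.
have [h1 _] := weighted_degree_edge xy; have [_ h2] := weighted_degree_edge yx.
(* The common edge would have a label at most 1 and at least 2. *)
by move: h1 h2; rewrite wx wy (setUC [set y]) t2; lia.
Qed.

End LowerBound.

(** * The ceiling formula and the case distinction *)

(** The quotient is [K + 1 + (w-1)/(2k)] with [0 < w-1 <= 2k]. *)
Lemma ceil_order (n k K w : nat) : 0 < k -> 1 < w <= 2 * k + 1 ->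
  n = 2 * (k * K) + w ->
  `|Num.ceil ((n%:R + 2 * k%:R - 1) / (2 * k%:R) : rat)%R|%N = K.+2.
Proof.
move=> k0 /andP[w1 wk] nE; rewrite (@Num.Theory.ceil_def _ _ K.+2%:Z) //.
have kR : (0 < 2 * k%:R :> rat)%R by rewrite -natrM ltr0n; lia.
have w1R : (2 <= w%:R :> rat)%R by rewrite ler_nat.
have wkR : (w%:R <= 2 * k%:R + 1 :> rat)%R by rewrite -natrM natr1 ler_nat; lia.
rewrite ltr_pdivlMr // ler_pdivrMr // nE natrD !natrM intrD.
have -> : (K.+2%:Z%:~R = K%:R + 2 :> rat)%R by rewrite -natrD addn2.
by apply/andP; split; lra.
Qed.

Unset Implicit Arguments.

Theorem theorem1p3 (n k : nat) (hk : 2 <= k) (hn : 2 * k + 1 <= n) :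
  let c : nat :=
    `|Num.ceil ((n%:R + 2 * k%:R - 1) / (2 * k%:R) : rat)%R|%N in
  irregularity_strength (cycle_power n k)
    (if ((n %% (4 * k) == 2 * k + 1) && (k %% 2 == 1)) || (n == 2 * k + 1)
     then c + 1 else c).
Proof.
move=> c; have k1 := hk; have kn : 2 * k < n by rewrite -addn1.
have k2 : 0 < 2 * k by lia.
(* Dividing [n - 2] instead of [n] puts the remainder [w] in the range from 2 to [2k+1]. *)
set K := (n - 2) %/ (2 * k); set w := (n - 2) %% (2 * k) + 2.
have w1 : 1 < w by rewrite /w; lia.
have wk : w <= 2 * k + 1 by have := ltn_pmod (n - 2) k2; rewrite /w; lia.
have nE : n = 2 *
  (k * K) + w by rewrite /w addnA mulnA [2 * k * K]mulnC -divn_eq subnK; lia.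
clearbody K w; have cE : c = K.+2 by apply: (ceil_order _ _ nE); [lia|rewrite w1].
rewrite cE {c cE}.
have low t : has_irregular_labelling (cycle_power n k) t -> K.+2 <= t.
  case=> l [lt linj]; have := order_le kn lt linj.
  case: (leqP K.+2 t) => // tK.
  have : k * t <= k * K.+1 by rewrite leq_mul2l -ltnS tK orbT.
  by rewrite mulnS; lia.
case: ifP => cond; last first.
  (* [K = 0] would give [n = w = 2k+1], an exceptional case. *)
  split=> //; have K0 : 0 < K.
    by case: (posnP K) cond nE => [-> cond|//]; rewrite muln0; lia.
  case: (boolP (odd k)) => ok; last exact: (even_labelling k1 w1 wk nE kn).
  case: (boolP (odd K)) => oK.
    case: (ltnP w.+1 (2 * k)) => hw.
      exact: (odd_odd_low_labelling k1 w1 wk nE kn).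
    exact: (odd_odd_high_labelling k1 w1 wk nE kn).
  case: (ltngtP w (2 * k)) => hw.
  - exact: (odd_even_labelling k1 w1 wk nE kn).
  - have wE : w = 2 * k + 1 by lia.
    have nmod : n = K./2 * (4 * k) + (2 * k + 1) by nia.
    by move: cond; rewrite nmod modnMDl modn_small ?eqxx ?modn2 ?ok //; lia.
  - exact: (odd_even_full_labelling k1 w1 wk nE kn).
(* Residue [2k+1] modulo [4k] means [w = 2k+1] with [K] even; [n = 2k+1] means moreover [K = 0]. *)
have [wE oK] : w = 2 * k + 1 /\ (odd k ==> ~~ odd K).
  case/orP: cond => [/andP[/eqP nmod kodd]|/eqP nk]; last first.
    have K0 : K = 0.
      by case: (posnP K) => // K0; have := leq_pmulr k K0; lia.
    by move: nE; rewrite K0 muln0 implybT; split; lia.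
  have nE2 := divn_eq n (4 * k); rewrite nmod in nE2.
  have [] := @euclid_inj (2 * k) K (2 * (n %/ (4 * k))) (w - 2) (2 * k - 1); lia.
rewrite addn1; split; first exact: (exceptional_labelling k1 w1 wk nE kn).
move=> t ht; have := low t ht; rewrite leq_eqVlt => /orP[/eqP tE|//].
case: ht => l [lt linj].
have tight : n + 2 * k = 2 * k * t + 1 by rewrite -tE nE wE !mulnS -mulnA; lia.
case/orP: cond => [/andP[/eqP nmod kodd]|/eqP nk].
  have := sum_weighted_degrees_tight kn lt linj tight.
  (* For odd [n] the binomial is [n] times [n.-1./2 = k(K+1)], a product of odd numbers. *)
  rewrite mulnCA (dvdn_addr _ (dvdn_mulr _ (dvdnn 2))) bin2odd; last by lia.
  rewrite (_ : n.-1./2 = k * K.+1) ?mulnS ?dvdn2 ?oddM ?oddD ?oddM; lia.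
have [k0 t2] : 0 < k /\ t = 2 by nia.
by have := tight_complete kn lt linj tight k0 nk; rewrite t2.
Qed.
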